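(* Let $s\in(0,1)$ and let $\{X_n\}_{n\in\mathbb{N}}$ be a Manneville-Pomeau process with parameter $s$, $X_n=\varphi(T_s^n(U_0))$, where $\varphi\in\mathcal{L}^1(\mu_s)$ is an almost everywhere increasing function, and let $F_0$ be the distribution function of $U_0$. Then, for any $t,h\in\mathbb{N}$ with $h\neq 0$ and all $(u,v)\in I^2$, $$C_{X_t,X_{t+h}}(u,v)=\left(\sum_{k=0}^{n_0-1}\big[\mathcal{F}_{h,k}(v)-F_0(a_{h,k})\big]\right)\delta_{\mathbb{N}^*}(n_0)+\min\big\{u,\mathcal{F}_{h,n_0}(v)\big\}-F_0(a_{h,n_0}),$$ where $\delta_{\mathbb{N}^*}(x)$ equals $1$ if $x\in\mathbb{N}^*$ and $0$ otherwise, $\{a_{h,k}\}_{k=0}^{2^h}$ are the end points of the nodes of $T_s^h$, and $n_0=n_0(u;h)\in\{0,\dots,2^h-1\}$ is the index $k$ for which $u\in[F_0(a_{h,k}),F_0(a_{h,k+1}))$ (with $n_0=2^h-1$ if $u=1$).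
   Context: $I=[0,1]$, $\mathbb{N}=\{0,1,2,\dots\}$, $\mathbb{N}^*=\mathbb{N}\setminus\{0\}$, $\lambda$ is Lebesgue measure on $I$. For $s>0$ the Manneville-Pomeau transformation $T_s:I\to I$ is $T_s(x)=x+x^{1+s}\ (\mathrm{mod}\ 1)$, i.e. $T_s(x)=x+x^{1+s}$ if $x+x^{1+s}<1$ and $T_s(x)=x+x^{1+s}-1$ otherwise; $T_s^k$ is its $k$-fold composition. For $s\in(0,1)$, $\mu_s$ denotes the $T_s$-invariant Borel probability measure on $I$ that is absolutely continuous with respect to $\lambda$; it is ergodic and has a positive density, so $F_0(x):=\mu_s([0,x])$ is a continuous, strictly increasing bijection of $I$. $U_0$ is a random variable with law $\mu_s$, and for $\varphi:I\to\mathbb{R}$ in $\mathcal{L}^1(\mu_s)$ the process $X_t=\varphi(T_s^t(U_0))$, $t\in\mathbb{N}$, is a Manneville-Pomeau (MP) process with parameter $s$. ''Almost everywhere increasing'' means strictly increasing on $I\setminus N$ for some $\lambda$-null set $N$. $C_{X,Y}$ denotes the copula of the pair of (continuous) random variables $(X,Y)$. $T_s^h$ has $2^h$ branches (maximal intervals of continuity), on each of which it is continuous and strictly increasing; $0=a_{h,0}<a_{h,1}<\dots<a_{h,2^h}=1$ are the end points of these branches, and $[a_{h,k},a_{h,k+1})$ is called the $k$-th node of $T_s^h$. $\mathcal{T}_{h,k}:I\to[a_{h,k},a_{h,k+1}]$ is the inverse of $T_s^h$ restricted to its $k$-th node (extended by continuity, so $\mathcal{T}_{h,k}(0)=a_{h,k}$,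 $\mathcal{T}_{h,k}(1)=a_{h,k+1}$). For $k=0,\dots,2^h-1$, $\mathcal{F}_{h,k}:I\to[F_0(a_{h,k}),F_0(a_{h,k+1})]$ is $\mathcal{F}_{h,k}(x)=F_0\big(\mathcal{T}_{h,k}(F_0^{-1}(x))\big)$. *)

(* Defs.v *)
From HB Require Import structures.
From mathcomp Require Import all_boot all_order all_algebra.
From mathcomp Require Import finmap.
From mathcomp Require Import all_classical all_reals all_analysis.

Set Implicit Arguments.
Unset Strict Implicit.
Unset Printing Implicit Defensive.

Import Order.TTheory GRing.Theory Num.Theory.
Import numFieldNormedType.Exports.

Local Open Scope classical_set_scope.
Local Open Scope ring_scope.

(* Functions and measures on I = [0, 1] are represented by functions and
   measures on R; their values outside I are irrelevant. *)

Section MannevillePomeau.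
Context {R : realType}.
Implicit Types (s u x : R) (h k : nat) (J K : set R).

Definition mp_map s x : R :=
  if x + x `^ (1 + s) < 1 then x + x `^ (1 + s) else x + x `^ (1 + s) - 1.

(* Invariant a.c. probability measures.  For 0 < s < 1 there is exactly one;
   its density is positive. *)
Definition is_mp_measure s (mu : probability R R) : Prop :=
  [/\ mu `[0, 1]%classic = 1%E,
      forall A, measurable A -> mu (`[0, 1]%classic `&` mp_map s @^-1` A) = mu A &
      mu `<< @lebesgue_measure R].

Definition ae_increasing (phi : R -> R) : Prop :=
  exists2 N : set R, (@lebesgue_measure R).-negligible N &
    {in `[0, 1]%classic `\` N &, {homo phi : x y / x < y}}.

Definition is_branch (f : R -> R) J : Prop :=
  [/\ J `<=` `[0, 1]%classic, is_interval J, {within J, continuous f} &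
      forall K, K `<=` `[0, 1]%classic -> is_interval K -> {within K, continuous f} ->
        J `<=` K -> K = J].

Definition branch_endpoints (f : R -> R) : set R :=
  [set inf J | J in is_branch f] `|` [set sup J | J in is_branch f].

(* a_{h,k}: the end points of the branches of T_s^h, in increasing order. *)
Definition node s h k : R :=
  nth 0 (sort <=%R (fset_set (branch_endpoints (iter h (mp_map s))))) k.

(* The case y = 1 is the extension by continuity: on the k-th node, T_s^h has
   left limit 1 at a_{h,k+1}. *)
Definition node_inverse s h k (y : R) : R :=
  if y < 1 then pinv `[node s h k, node s h k.+1[%classic (iter h (mp_map s)) y
  else node s h k.+1.

Definition mp_cdf (mu : probability R R) x : R := fine (mu `[0, x]%classic).

Definition mp_F (mu : probability R R) s h k x : R :=
  mp_cdf mu (node_inverse s h k (pinv (`[0, 1]%classic : set R) (mp_cdf mu) x)).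

Definition mp_index (mu : probability R R) s h u : nat :=
  if u == 1 then (2 ^ h).-1%N
  else find (fun k => mp_cdf mu (node s h k) <= u < mp_cdf mu (node s h k.+1))
            (iota 0 (2 ^ h)%N).

End MannevillePomeau.

Section Copula.
Context {R : realType}.

Definition is_copula (C : R -> R -> R) : Prop :=
  [/\ forall u, u \in `[0, 1] -> C u 0 = 0 /\ C 0 u = 0,
      forall u, u \in `[0, 1] -> C u 1 = u /\ C 1 u = u &
      forall u1 u2 v1 v2,
        0 <= u1 -> u1 <= u2 -> u2 <= 1 -> 0 <= v1 -> v1 <= v2 -> v2 <= 1 ->
        0 <= C u2 v2 - C u2 v1 - C u1 v2 + C u1 v1].

Context {d : measure_display} {Om : measurableType d} (P : probability Om R).

Definition is_copula_of (X Y : {RV P >-> R}) (C : R -> R -> R) : Prop :=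
  is_copula C /\
  forall x y, fine (P [set w | X w <= x /\ Y w <= y]) =
              C (fine (cdf X x)) (fine (cdf Y y)).

(* By Sklar's theorem, uniquely determined on I^2 when X and Y have continuous
   distribution functions. *)
Definition copula (X Y : {RV P >-> R}) : R -> R -> R :=
  xget (fun _ _ => 0) (is_copula_of X Y).

(* U0 has law mu and X_t = phi (T_s^t (U0)). *)
Definition is_mp_process (s : R) (mu : probability R R) (U0 : {RV P >-> R})
    (phi : R -> R) (X : nat -> {RV P >-> R}) : Prop :=
  (forall A, measurable A -> distribution P U0 A = mu A) /\
  forall t w, X t w = phi (iter t (mp_map s) (U0 w)).

End Copula.

(* Main.v *)
Require Import Defs.
From HB Require Import structures.
From mathcomp Require Import all_boot all_order all_algebra.
From mathcomp Require Import all_classical all_reals all_analysis.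
From mathcomp Require Import measurable_realfun lra.
Import Order.TTheory GRing.Theory Num.Theory.
Import numFieldNormedType.Exports.
Local Open Scope classical_set_scope.
Local Open Scope ring_scope.

Set Implicit Arguments.
Unset Strict Implicit.

(** Write F for [mp_cdf mu], T for the Manneville-Pomeau map, and
      J(a, b) = mu([0, a] `&` T^-h [0, b])
    for the joint distribution function of (U0, T^h U0).

    The measure mu has no atoms, so F maps [0, 1] onto [0, 1].  By invariance
    both margins of J are F, hence J(a, b) depends on a and b only through F a
    and F b, and C(F a, F b) = J(a, b) defines a copula C
    ([invariant_copulaP]).  Since phi is strictly increasing off a null set,
    each event X_t <= x is, up to a null event, of the form T^t U0 <= a
    ([cuts_exists], [process_le_ae]); so C is a copula of (X_t, X_{t+h}), and
    it is the only one on the unit square, because the values F a with a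
    outside the null set are dense and copulas are Lipschitz
    ([copula_eq_of_dense], [process_copula]).

    It remains to compute J.  The map T has two increasing branches, each onto
    [0, 1[; composing inverse branches gives 2^h such branches of T^h, with end
    points b_0 < ... < b_{2^h} ([full_branches_iter]).  At an interior b_k the
    map T^h jumps from 1 to 0, so these are exactly its maximal intervals of
    continuity and the b_k are the nodes ([branch_endpointsE]).  On the k-th
    one, T^h z <= y means z <= g_k(y) with g_k the inverse branch, so the
    event T^h z <= y meets each complete branch in [b_k, g_k(y)] and, below a
    point x of the n-th branch, that branch in [b_n, min(x, g_n(y))].  Applying
    F gives the formula ([joint_cdf_in_branch]). *)

(** * Distribution functions without atoms *)

Lemma measure_eq_off_null (d : measure_display) (T : measurableType d)
    (R : realType) (m : {measure set T -> \bar R}) (Z A B : set T) :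
  measurable Z -> measurable A -> measurable B -> m Z = 0%E ->
  (forall z, ~ Z z -> A z <-> B z) -> m A = m B.
Proof.
move=> mZ mA mB Z0 AB; rewrite -(measureU0 mA mZ Z0) -(measureU0 mB mZ Z0).
congr (m _); apply/seteqP; split=> z [Az|Zz]; try by right.
- by have [Zz|/AB/iffLR h] := pselect (Z z); [right|left; exact: h].
- by have [Zz|/AB/iffRL h] := pselect (Z z); [right|left; exact: h].
Qed.

Section ContinuousLaw.
Context {R : realType} (mu : probability R R).
Context (mu01 : mu `[0, 1]%classic = 1%E).
Context (mu1 : forall x, mu [set x] = 0%E).

Local Notation F := (mp_cdf mu).

Lemma fine_prob_le (A B : set R) : measurable A -> measurable B -> A `<=` B ->
  fine (mu A) <= fine (mu B).
Proof.
by move=> mA mB AB; rewrite fine_le ?fin_num_measure// le_measure ?inE.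
Qed.

Lemma fine_prob_ge0 (A : set R) : 0 <= fine (mu A).
Proof. by rewrite fine_ge0. Qed.

Lemma fine_prob_split (E : set R) (a b : R) : measurable E -> 0 <= a -> a <= b ->
  fine (mu (`[0, b] `&` E)) = fine (mu (`[0, a] `&` E)) + fine (mu (`]a, b] `&` E)).
Proof.
move=> mE a0 ab; rewrite -fineD ?fin_num_measure//; try exact: measurableI.
rewrite -measureU//; try exact: measurableI.
  congr (fine (mu _)); rewrite -setIUl; congr (_ `&` _).
  apply/seteqP; split=> z /=; rewrite !in_itv/=.
    by move=> /andP[z0 zb]; rewrite z0 zb andbT/= ltNge; case: (leP z a); [left|right].
  by case=> /andP[h1 h2]; apply/andP; lra.
apply/seteqP; split=> z //= -[[+ _] [+ _]]; rewrite !in_itv/= => /andP[h1 h2] /andP[h3 h4].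
by lra.
Qed.

Lemma mp_cdf_split (a b : R) : 0 <= a -> a <= b ->
  F b = F a + fine (mu `]a, b]%classic).
Proof.
by move=> a0 ab; have := @fine_prob_split setT a b measurableT a0 ab; rewrite !setIT.
Qed.

Lemma mp_cdf_le (a b : R) : a <= b -> F a <= F b.
Proof.
move=> ab; apply: fine_prob_le => // z /=; rewrite !in_itv/= => /andP[-> /=].
by move/le_trans; apply.
Qed.

Lemma mp_cdf0 : F 0 = 0.
Proof. by rewrite /mp_cdf set_itv1 mu1. Qed.

Lemma mp_cdf1 : F 1 = 1.
Proof. by rewrite /mp_cdf mu01. Qed.

Lemma mp_cdf_01 (a : R) : 0 <= a <= 1 -> 0 <= F a <= 1.
Proof. by move=> /andP[a0 a1]; rewrite -{1}mp_cdf0 -mp_cdf1 !mp_cdf_le. Qed.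

(** The intermediate value theorem for F at a = sup {x | F x <= v}: the sets
    [0, a - 1/n] exhaust [0, a[, which has the mass of [0, a] as {a} is null,
    and the sets [0, a + 1/n] shrink to [0, a]; so F a is squeezed between
    values on either side of v. *)
Lemma mp_cdf_surj (v : R) : 0 <= v <= 1 -> exists2 a, 0 <= a <= 1 & F a = v.
Proof.
move=> /andP[v0 v1]; pose S := [set x : R | 0 <= x <= 1 /\ F x <= v].
have S0 : S 0 by split; [rewrite lexx ler01 | rewrite mp_cdf0].
have hS : has_sup S by split; [exists 0|exists 1 => x -[/andP[]]].
have a0 : 0 <= sup S by exact: ub_le_sup hS.2 0 S0.
have a1 : sup S <= 1 by apply: ge_sup => [|x [/andP[]]//]; exists 0.
have fE A : measurable A -> (fine (mu A))%:E = mu A.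
  by move=> mA; rewrite fineK ?fin_num_measure.
exists (sup S); first by rewrite a0.
apply/eqP; rewrite eq_le; apply/andP; split.
  have -> : F (sup S) = fine (mu `[0, sup S[%classic).
    congr fine; apply: (measure_eq_off_null (m := mu) (Z := [set sup S])) => //.
      exact: mu1.
    move=> z /= zS.
    rewrite !in_itv/= lt_neqAle; have -> // : z != sup S by apply/eqP.
  rewrite -lee_fin fE//.
  have UE : `[0, sup S[%classic = \bigcup_n `[0, sup S - n.+1%:R^-1]%classic.
    apply/seteqP; split=> [z|z [n _]] /=; rewrite !in_itv/= => /andP[z0 zS].
      have d0 : 0 < sup S - z by lra.
      have [n] := ltr_add_invr d0; rewrite add0r => hn.
      exists n => //=; rewrite in_itv/= z0/=.
      by move: hn; move: (n.+1%:R^-1) => e; lra.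
    have : 0 < n.+1%:R^-1 :> R by [].
    by move: zS; move: (n.+1%:R^-1) => e; lra.
  rewrite UE; apply: (cvge_le (F := \oo)
    (f := mu \o (fun n => `[0, sup S - n.+1%:R^-1]%classic))); last first.
    apply: nondecreasing_cvg_mu => //; first exact: bigcup_measurable.
    move=> m n mn; apply/subsetPset => z /=; rewrite !in_itv/= => /andP[-> /=].
    move=> /le_trans; apply; rewrite lerD2l lerN2 lef_pV2 ?posrE// ler_nat.
    by rewrite ltnS.
  apply: nearW => n /=; rewrite -fE// lee_fin.
  have n0 : 0 < n.+1%:R^-1 :> R by [].
  have [x [_ xv]] := sup_adherent n0 hS.
  by move=> /ltW /mp_cdf_le /le_trans; apply.
rewrite -lee_fin fE//.
have -> : `[0, sup S]%classic = \bigcap_n `[0, sup S + n.+1%:R^-1]%classic.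
  apply/seteqP; split=> [z /=|z zn /=].
    rewrite in_itv/= => /andP[z0 zS] n _ /=; rewrite in_itv/= z0/=.
    have : 0 < n.+1%:R^-1 :> R by [].
    by move: zS; move: (n.+1%:R^-1) => e; lra.
  have := zn 0%N I; rewrite /= !in_itv/= => /andP[-> _]/=; rewrite leNgt.
  apply/negP => zS; have d0 : 0 < z - sup S by lra.
  have [n] := ltr_add_invr d0; rewrite add0r => hn.
  have := zn n I; rewrite /= in_itv/= => /andP[_].
  by move: hn; move: (n.+1%:R^-1) => e; lra.
apply: (cvge_ge (F := \oo)
    (f := mu \o (fun n => `[0, sup S + n.+1%:R^-1]%classic))); last first.
  apply: nonincreasing_cvg_mu => //.
  - by rewrite -ge0_fin_numE// fin_num_measure.
  - exact: bigcap_measurable.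
  move=> m n mn; apply/subsetPset => z /=; rewrite !in_itv/= => /andP[-> /=].
  move=> /le_trans; apply; rewrite lerD2l lef_pV2 ?posrE// ler_nat.
  by rewrite ltnS.
apply: nearW => n /=; rewrite -fE// lee_fin.
have n0 : 0 < n.+1%:R^-1 :> R by [].
have [h1|h1] := leP (sup S + n.+1%:R^-1) 1; last first.
  by apply: le_trans v1 _; have := mp_cdf_le (ltW h1); rewrite mp_cdf1.
rewrite leNgt; apply/negP => /ltW h2.
have := @ub_le_sup _ S hS.2 (sup S + n.+1%:R^-1).
have hm : S (sup S + n.+1%:R^-1).
  split=> //; move: h1 n0; move: (n.+1%:R^-1) => e h1 n0.
  by apply/andP; split=> //; lra.
by move/(_ hm); move: n0; move: (n.+1%:R^-1) => e n0; lra.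
Qed.
(** The right inverse of F by which [mp_F] evaluates F^-1. *)
Definition mp_quantile (u : R) : R := pinv (`[0, 1]%classic : set R) F u.

Lemma mp_quantileP (u : R) : 0 <= u <= 1 ->
  0 <= mp_quantile u <= 1 /\ F (mp_quantile u) = u.
Proof.
move=> uI.
have surjF : set_surj (`[0, 1]%classic : set R) `[0, 1]%classic F.
  move=> v /=; rewrite in_itv/= => /mp_cdf_surj[a aI <-].
  by exists a => //=; rewrite in_itv.
have uI' : (`[0, 1]%classic : set R) u by rewrite /= in_itv.
split; last by apply: (@surjpK _ _ (fun=> point) _ _ _ surjF); rewrite inE.
have /(_ _ (imageP _ uI')) := @surjpinv_image_sub _ _ (fun=> point) _ _ _ surjF.
by rewrite /= in_itv.
Qed.

End ContinuousLaw.

(** * Copulas, and the copula of a point and its image *)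

(** Monotonicity and 1-Lipschitz continuity: the increments of C are masses
    of rectangles, bounded by the masses of the strips that contain them,
    which the uniform margins determine. *)
Lemma copula_le (R : realType) (C : R -> R -> R) (u1 u2 v1 v2 : R) :
  is_copula C -> 0 <= u1 -> u1 <= u2 -> u2 <= 1 -> 0 <= v1 -> v1 <= v2 -> v2 <= 1 ->
  C u1 v1 <= C u2 v2 <= C u1 v1 + (u2 - u1) + (v2 - v1).
Proof.
move=> [C0 C1 Crect] u10 u12 u21 v10 v12 v21.
have := Crect u1 u2 0 v1 u10 u12 u21 (lexx _) v10 (le_trans v12 v21).
have := Crect u1 u2 v1 1 u10 u12 u21 v10 (le_trans v12 v21) (lexx _).
have := Crect 0 u2 v1 v2 (lexx _) (le_trans u10 u12) u21 v10 v12 v21.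
have := Crect u2 1 v1 v2 (le_trans u10 u12) u21 (lexx _) v10 v12 v21.
have u1I : u1 \in `[0, 1] by rewrite in_itv/=; lra.
have u2I : u2 \in `[0, 1] by rewrite in_itv/=; lra.
have v1I : v1 \in `[0, 1] by rewrite in_itv/=; lra.
have v2I : v2 \in `[0, 1] by rewrite in_itv/=; lra.
have [-> _] := C0 _ u1I; have [-> _] := C0 _ u2I.
have [_ ->] := C0 _ v1I; have [_ ->] := C0 _ v2I.
have [-> _] := C1 _ u1I; have [-> _] := C1 _ u2I.
have [_ ->] := C1 _ v1I; have [_ ->] := C1 _ v2I.
lra.
Qed.

(** The uniqueness half of Sklar's theorem.  Density is asked in the order sense,
    in every [w, w'], so that near 0 and 1 it yields points inside [0, 1]. *)
Lemma copula_eq_of_dense (R : realType) (S : set R) (C D : R -> R -> R) :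
  is_copula C -> is_copula D ->
  (forall w w', 0 <= w -> w < w' -> w' <= 1 -> exists2 z, S z & w <= z <= w') ->
  (forall z z', S z -> S z' -> C z z' = D z z') ->
  forall u v, 0 <= u <= 1 -> 0 <= v <= 1 -> C u v = D u v.
Proof.
move=> hC hD dS CD.
have approx (e u : R) : 0 < e -> 0 <= u <= 1 -> exists u1 u2 z : R,
    [/\ S z, 0 <= u1 /\ u2 <= 1, u1 <= u <= u2, u1 <= z <= u2 & u2 - u1 <= 2 * e].
  move=> e0 /andP[u0 u1].
  (* an interval of length at most 2 e around u that stays inside [0, 1] *)
  have [ue|ue] := leP (u + e) 1.
    have [|z Sz hz] := dS u (u + e) u0 _ ue; first lra.
    by exists u, (u + e), z; split=> //; lra.
  have [eu|eu] := leP 0 (u - e).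
    have [|z Sz hz] := dS (u - e) u eu _ u1; first lra.
    by exists (u - e), u, z; split=> //; lra.
  have [z Sz hz] := dS 0 1 (lexx _) ltr01 (lexx _).
  by exists 0, 1, z; split=> //; lra.
suff le_CD (A B : R -> R -> R) u v : is_copula A -> is_copula B ->
    (forall z z', S z -> S z' -> A z z' = B z z') ->
    0 <= u <= 1 -> 0 <= v <= 1 -> A u v <= B u v.
  move=> u v uI vI; apply/eqP; rewrite eq_le !le_CD// => z z' Sz Sz'.
  by rewrite CD.
move=> hA hB AB uI vI; apply/ler_addgt0Pr => e e0.
have e40 : 0 < e / 8 by lra.
have [u1 [u2 [z [Sz [u10 u21] /andP[h1 h2] /andP[h3 h4] hu]]]] := approx _ _ e40 uI.
have [v1 [v2 [z' [Sz' [v10 v21] /andP[k1 k2] /andP[k3 k4] hv]]]] := approx _ _ e40 vI.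
have /andP[_ a1] := copula_le hA u10 (le_trans h1 h2) u21 v10 (le_trans k1 k2) v21.
have /andP[a2 _] := copula_le hA u10 h3 (le_trans h4 u21) v10 k3 (le_trans k4 v21).
have /andP[a3 _] := copula_le hA (le_trans u10 h1) h2 u21 (le_trans v10 k1) k2 v21.
have /andP[_ b1] := copula_le hB u10 (le_trans h1 h2) u21 v10 (le_trans k1 k2) v21.
have /andP[b2 _] := copula_le hB u10 h1 (le_trans h2 u21) v10 k1 (le_trans k2 v21).
have /andP[b3 _] := copula_le hB (le_trans u10 h3) h4 u21 (le_trans v10 k3) k4 v21.
by rewrite (AB z z' Sz Sz') in a2; lra.
Qed.

Section InvariantLaw.
Context {R : realType} (mu : probability R R) (f : R -> R).
Context (mu01 : mu `[0, 1]%classic = 1%E).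
Context (mu1 : forall x, mu [set x] = 0%E).
Context (mf : measurable_fun setT f).
Context (f01 : forall x, 0 <= x <= 1 -> 0 <= f x <= 1).
Context (mu_inv : forall A, measurable A ->
  mu (`[0, 1]%classic `&` f @^-1` A) = mu A).

Local Notation F := (mp_cdf mu).

Definition joint_cdf (a b : R) : R :=
  fine (mu (`[0, a]%classic `&` f @^-1` `[0, b]%classic)).

Let mpre (A : set R) : measurable A -> measurable (f @^-1` A).
Proof. by move=> mA; rewrite -[X in measurable X]setTI; exact: mf. Qed.

(** Invariance makes the image of a mu-distributed point mu-distributed. *)
Lemma joint_cdf1l (b : R) : joint_cdf 1 b = F b.
Proof. by rewrite /joint_cdf mu_inv. Qed.

Lemma joint_cdf1r (a : R) : a <= 1 -> joint_cdf a 1 = F a.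
Proof.
move=> a1; congr (fine (mu _)); apply/seteqP; split=> [z []//|z /=].
rewrite !in_itv/= => /andP[z0 za]; split; first by rewrite z0.
by apply: f01; lra.
Qed.

(** The alternating sum is the mass of the points of ]a1, a2] whose image lies
    in ]b1, b2]. *)
Lemma joint_cdf_rect (a1 a2 b1 b2 : R) : 0 <= a1 -> a1 <= a2 -> b1 <= b2 ->
  0 <= joint_cdf a2 b2 - joint_cdf a2 b1 - joint_cdf a1 b2 + joint_cdf a1 b1.
Proof.
move=> a10 a12 b12; rewrite /joint_cdf.
rewrite (fine_prob_split mu (mpre (measurable_itv `[0, b2])) a10 a12).
rewrite (fine_prob_split mu (mpre (measurable_itv `[0, b1])) a10 a12).
set s1 := fine (mu (`]a1, a2] `&` f @^-1` `[0, b1])).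
set s2 := fine (mu (`]a1, a2] `&` f @^-1` `[0, b2])).
suff : s1 <= s2 by lra.
apply: fine_prob_le; try by apply: measurableI => //; exact: mpre.
by move=> z [h1 /=]; rewrite in_itv/= => /andP[h2 h3]; split=> //=; rewrite in_itv/= h2; lra.
Qed.

Lemma joint_cdf0l (b : R) : joint_cdf 0 b = 0.
Proof.
apply/eqP; rewrite eq_le fine_prob_ge0 andbT.
suff : joint_cdf 0 b <= F 0 by rewrite (mp_cdf0 mu1).
apply: fine_prob_le => //.
by apply: measurableI => //; exact: mpre.
Qed.

Lemma joint_cdf0r (a : R) : a <= 1 -> joint_cdf a 0 = 0.
Proof.
move=> a1; apply/eqP; rewrite eq_le fine_prob_ge0 andbT.
suff : joint_cdf a 0 <= joint_cdf 1 0 by rewrite joint_cdf1l (mp_cdf0 mu1).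
apply: fine_prob_le; try by apply: measurableI => //; exact: mpre.
move=> z [/= + h]; rewrite in_itv/= => /andP[z0 za]; split=> //=.
by rewrite in_itv/= z0 (le_trans za a1).
Qed.

(** By [joint_cdf_rect] an increment of the joint distribution function in one
    variable is at most the increment of the corresponding margin, which is F.
    Hence [joint_cdf] factors through F in each variable even where F could be
    constant, and any right inverse of F defines the same copula. *)
Lemma joint_cdf_eq (a a' b b' : R) : 0 <= a <= 1 -> 0 <= a' <= 1 ->
  0 <= b <= 1 -> 0 <= b' <= 1 -> F a = F a' -> F b = F b' ->
  joint_cdf a b = joint_cdf a' b'.
Proof.
have cstl (x x' y : R) : 0 <= x -> x <= x' -> x' <= 1 -> 0 <= y <= 1 -> F x = F x' ->
    joint_cdf x y = joint_cdf x' y.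
  move=> x0 xx' x'1 /andP[y0 y1] Fx.
  have := joint_cdf_rect x0 xx' y0; have := joint_cdf_rect x0 xx' y1.
  by rewrite !joint_cdf1r ?joint_cdf0r//; lra.
have cstr (x y y' : R) : 0 <= x <= 1 -> y <= y' -> F y = F y' ->
    joint_cdf x y = joint_cdf x y'.
  move=> /andP[x0 x1] yy' Fy.
  have := joint_cdf_rect (lexx _) x0 yy'; have := joint_cdf_rect x0 x1 yy'.
  by rewrite !joint_cdf1l !joint_cdf0l Fy; lra.
move=> aI a'I bI b'I Fa Fb; transitivity (joint_cdf a' b).
  have /andP[a0 a1] := aI; have /andP[a'0 a'1] := a'I.
  by have [aa'|/ltW aa'] := leP a a'; [exact: cstl|apply/esym/cstl].
by have [bb'|/ltW bb'] := leP b b'; [exact: cstr|apply/esym/cstr].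
Qed.

Definition invariant_copula (u v : R) : R :=
  joint_cdf (mp_quantile mu u) (mp_quantile mu v).

Lemma invariant_copula_cdf (a b : R) : 0 <= a <= 1 -> 0 <= b <= 1 ->
  invariant_copula (F a) (F b) = joint_cdf a b.
Proof.
move=> aI bI.
have [qaI qa] := mp_quantileP mu01 mu1 (mp_cdf_01 mu01 mu1 aI).
have [qbI qb] := mp_quantileP mu01 mu1 (mp_cdf_01 mu01 mu1 bI).
exact: joint_cdf_eq.
Qed.

Lemma invariant_copulaP : is_copula invariant_copula.
Proof.
split=> [u|u|u1 u2 v1 v2 u10 u12 u21 v10 v12 v21].
- rewrite in_itv/= => uI; have [a aI <-] := mp_cdf_surj mu01 mu1 uI.
  have I0 : 0 <= (0 : R) <= 1 by lra.
  rewrite -{1 3}(mp_cdf0 mu1) !invariant_copula_cdf//.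
  by rewrite joint_cdf0l joint_cdf0r//; case/andP: aI.
- rewrite in_itv/= => uI; have [a aI <-] := mp_cdf_surj mu01 mu1 uI.
  have I1 : 0 <= (1 : R) <= 1 by lra.
  rewrite -{1 2}(mp_cdf1 mu01) !invariant_copula_cdf//.
  by rewrite joint_cdf1l joint_cdf1r//; case/andP: aI.
have q_le w w' : 0 <= w -> w <= w' -> w' <= 1 ->
    mp_quantile mu w <= mp_quantile mu w'.
  move=> w0; rewrite le_eqVlt => /predU1P[->//|ww' w'1].
  have wI : 0 <= w <= 1 by lra.
  have w'I : 0 <= w' <= 1 by lra.
  have [_ hw] := mp_quantileP mu01 mu1 wI; have [_ hw'] := mp_quantileP mu01 mu1 w'I.
  rewrite leNgt; apply/negP => /ltW/(mp_cdf_le mu); rewrite hw hw'; lra.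
apply: joint_cdf_rect; [|exact: q_le..].
have u1I : 0 <= u1 <= 1 by lra.
by have [/andP[]] := mp_quantileP mu01 mu1 u1I.
Qed.

(** If every point of [a, a'] were in the null set B, then F would not grow
    from a to a'. *)
Lemma mp_cdf_dense (B : set R) : measurable B -> mu B = 0%E ->
  forall w w', 0 <= w -> w < w' -> w' <= 1 ->
  exists2 z, [set F a | a in [set a | 0 <= a <= 1 /\ ~ B a]] z & w <= z <= w'.
Proof.
move=> mB B0 w w' w0 ww' w'1.
have [a aI Fa] : exists2 a, 0 <= a <= 1 & F a = w by apply: mp_cdf_surj => //; lra.
have [a' a'I Fa'] : exists2 a, 0 <= a <= 1 & F a = w' by apply: mp_cdf_surj => //; lra.
have aa' : a <= a'.
  by rewrite leNgt; apply/negP => /ltW/(mp_cdf_le mu); rewrite Fa Fa'; lra.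
have [[z [zB za]]|nz] := pselect (exists z, ~ B z /\ a <= z <= a').
  exists (F z); first by exists z => //; split=> //; lra.
  by rewrite -Fa -Fa' !mp_cdf_le//; lra.
have aa'B : `]a, a']%classic `<=` B.
  move=> z /=; rewrite in_itv/= => hz; apply: contrapT => zB; apply: nz.
  by exists z; split=> //; lra.
have := mp_cdf_split mu _ aa'; rewrite Fa Fa' (subset_measure0 _ _ aa'B)//=.
by move/(_ (proj1 (andP aI))); lra.
Qed.

End InvariantLaw.

(** * Monotone observables of a measure-preserving map *)

Section Process.
Context {R : realType} (mu : probability R R) (T : R -> R).
Context (mu01 : mu `[0, 1]%classic = 1%E).
Context (mu1 : forall x, mu [set x] = 0%E).
Context (mT : measurable_fun setT T).
Context (T01 : forall x, 0 <= x <= 1 -> 0 <= T x <= 1).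
Context (mu_inv : forall A, measurable A ->
  mu (`[0, 1]%classic `&` T @^-1` A) = mu A).

Local Notation F := (mp_cdf mu).

Lemma measurable_iter (n : nat) : measurable_fun setT (iter n T).
Proof.
elim: n => [|n IHn]; first exact: measurable_id.
exact: (measurableT_comp mT IHn).
Qed.

Lemma iter_01 (n : nat) (x : R) : 0 <= x <= 1 -> 0 <= iter n T x <= 1.
Proof. by move=> xI; elim: n => [|n IHn] //=; exact: T01. Qed.

Let mpre (g : R -> R) (A : set R) :
  measurable_fun setT g -> measurable A -> measurable (g @^-1` A).
Proof. by move=> mg mA; rewrite -[X in measurable X]setTI; exact: mg. Qed.

Let mu_offI : mu (~` `[0, 1]%classic) = 0%E.
Proof. by rewrite probability_setC// mu01 subee. Qed.

(** As [0, 1] has full mass, the restriction to it in the invariance of mu can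
    be dropped. *)
Lemma mu_preimage_iter (n : nat) (A : set R) :
  measurable A -> mu (iter n T @^-1` A) = mu A.
Proof.
elim: n A => [//|n IHn] A mA.
have mTA : measurable (T @^-1` A) by exact: mpre.
rewrite (_ : iter n.+1 T @^-1` A = iter n T @^-1` (T @^-1` A))// IHn// -[RHS]mu_inv//.
apply: (measure_eq_off_null (m := mu) (Z := ~` `[0, 1]%classic)) => //.
- exact: measurableC.
- exact: measurableI.
- by move=> z /contrapT zI; split=> [|[]].
Qed.

Lemma iter_inv (n : nat) (A : set R) : measurable A ->
  mu (`[0, 1]%classic `&` iter n T @^-1` A) = mu A.
Proof.
move=> mA; rewrite -(mu_preimage_iter n mA).
have mn := mpre (measurable_iter n) mA.
apply: (measure_eq_off_null (m := mu) (Z := ~` `[0, 1]%classic)) => //.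
- exact: measurableC.
- exact: measurableI.
- by move=> z /contrapT zI; split=> [[]|].
Qed.

Context (B : set R) (mB : measurable B) (B0 : mu B = 0%E) (phi : R -> R).
Context (phi_inc : forall x y, 0 <= x -> x < y -> y <= 1 -> ~ B x -> ~ B y ->
  phi x < phi y).

(** Off B, the set where phi <= x is the set of the points at most a.  The
    point a is excluded from the comparison: phi may jump there, and a single
    point has no mass. *)
Definition cuts (a x : R) : Prop := 0 <= a <= 1 /\
  forall z, 0 <= z <= 1 -> ~ B z -> z <> a -> (phi z <= x <-> z <= a).

(** The supremum of the points outside B with phi <= x works, as phi is
    increasing there; a = 0 when there is no such point. *)
Lemma cuts_exists (x : R) : exists a, cuts a x.
Proof.
pose S := [set z : R | [/\ 0 <= z <= 1, ~ B z & phi z <= x]].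
have [[s Ss]|S0] := pselect (S !=set0); last first.
  exists 0; split=> [|z /andP[z0 z1] Bz zn0]; first by rewrite lexx ler01.
  split=> [phizx|zle0]; last by case: zn0; apply/eqP; rewrite eq_le zle0.
  by case: S0; exists z; split=> //; rewrite z0.
have hS : has_sup S by split; [exists s|exists 1 => z [/andP[]]].
have supI : 0 <= sup S <= 1.
  apply/andP; split.
    by apply: le_trans (ub_le_sup hS.2 Ss); case: Ss => /andP[].
  by apply: ge_sup => [|z [/andP[]]]; first by exists s.
exists (sup S); split=> // z zI Bz zS; split=> [phizx|].
  by apply: (ub_le_sup hS.2); split.
rewrite le_eqVlt => /predU1P[//|zlt].
have d0 : 0 < sup S - z by lra.
have [y [yI By phiy] zy] := sup_adherent d0 hS.
apply: le_trans phiy; apply/ltW/phi_inc => //; lra.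
Qed.

Lemma cuts_self (a : R) : 0 <= a <= 1 -> ~ B a -> cuts a (phi a).
Proof.
move=> aI Ba; split=> // z zI Bz za; have [az|az] := leP z a.
  have zlta : z < a by rewrite lt_neqAle az andbT; apply/eqP.
  by split=> // _; apply/ltW/phi_inc => //; lra.
split=> //; rewrite leNgt; have -> // : phi a < phi z.
by apply: phi_inc => //; lra.
Qed.

Context (d : measure_display) (Om : measurableType d) (P : probability Om R).
Context (U0 : {RV P >-> R}) (X : nat -> {RV P >-> R}).
Context (U0_law : forall A, measurable A -> distribution P U0 A = mu A).
Context (X_def : forall t w, X t w = phi (iter t T (U0 w))).

(** The exceptional event is that T^t U0 leaves [0, 1], falls in B or hits a;
    T^t U0 has law mu, so it is null. *)
Lemma process_le_ae (t : nat) (a x : R) : cuts a x ->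
  exists2 Z, measurable Z /\ P Z = 0%E &
    forall w, ~ Z w -> X t w <= x <-> iter t T (U0 w) \in `[0, a].
Proof.
move=> [aI ax].
pose N := ~` `[0, 1]%classic `|` (B `|` [set a]).
have mI : measurable (~` `[0, 1]%classic : set R) by exact: measurableC.
have mBa : measurable (B `|` [set a]) by exact: measurableU.
have mN : measurable N by exact: measurableU.
have N0 : mu N = 0%E by rewrite (measureU0 mI mBa)// (measureU0 mB _ (mu1 a)).
have mtN := mpre (measurable_iter t) mN.
exists (U0 @^-1` (iter t T @^-1` N)).
  split; first by apply: measurable_funPTI.
  by have := U0_law mtN; rewrite mu_preimage_iter// N0.
move=> w; rewrite /preimage /= X_def in_itv/=; move: (iter t T (U0 w)) => z zN.
have zI : 0 <= z <= 1 by apply: contrapT => h; apply: zN; left; rewrite /= in_itv.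
have Bz : ~ B z by move=> h; apply: zN; right; left.
have za : z <> a by move=> h; apply: zN; right; right.
by have /andP[-> _] := zI; exact: ax.
Qed.

Let P_law (A : set R) : measurable A -> P (U0 @^-1` A) = mu A.
Proof. exact: U0_law. Qed.

Lemma process_cdf (t : nat) (a x : R) : cuts a x -> fine (cdf (X t) x) = F a.
Proof.
move=> ax; have [Z [mZ Z0] hZ] := process_le_ae t ax; congr fine.
rewrite -(mu_preimage_iter t)// -P_law; last exact: mpre (measurable_iter t) _.
apply: (measure_eq_off_null (m := P) mZ) => //; first exact: measurable_funPTI.
by apply: measurable_funPTI; exact: mpre (measurable_iter t) _.
Qed.

(** The event is that T^t U0 lies in [0, a] and T^h of it in [0, b]; as T^t U0
    has law mu, t disappears. *)
Lemma process_joint_cdf (t h : nat) (a x b y : R) : cuts a x -> cuts b y ->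
  fine (P [set w | X t w <= x /\ X (t + h)%N w <= y]) = joint_cdf mu (iter h T) a b.
Proof.
move=> ax cby; have [Z [mZ Z0] hZ] := process_le_ae t ax.
have [Z' [mZ' Z'0] hZ'] := process_le_ae (t + h) cby; congr fine.
have mA : measurable (`[0, a]%classic `&` iter h T @^-1` `[0, b]%classic).
  by apply: measurableI => //; exact: mpre (measurable_iter h) _.
rewrite -(mu_preimage_iter t)// -P_law; last exact: mpre (measurable_iter t) _.
apply: (measure_eq_off_null (m := P) (Z := Z `|` Z')).
- exact: measurableU.
- have -> : [set w | X t w <= x /\ X (t + h)%N w <= y] =
      X t @^-1` `]-oo, x]%classic `&` X (t + h)%N @^-1` `]-oo, y]%classic.
    by apply/seteqP; split=> w /=; rewrite !in_itv.
  by apply: measurableI; exact: measurable_funPTI.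
- by apply: measurable_funPTI; exact: mpre (measurable_iter t) _.
- by rewrite measureU0.
move=> w /not_orP[/hZ h1 /hZ']; rewrite /preimage /= addnC iterD => h2.
by rewrite h1 h2.
Qed.

Lemma process_copula (t h : nat) (u v : R) : 0 <= u <= 1 -> 0 <= v <= 1 ->
  copula (X t) (X (t + h)%N) u v = invariant_copula mu (iter h T) u v.
Proof.
have mh := measurable_iter h; have h01 := iter_01 h; have hinv := iter_inv h.
have hC := invariant_copulaP mu01 mu1 mh h01 hinv.
have hXY : is_copula_of (X t) (X (t + h)%N) (invariant_copula mu (iter h T)).
  split=> // x y; have [a ax] := cuts_exists x; have [b cby] := cuts_exists y.
  rewrite (process_joint_cdf t h ax cby) (process_cdf t ax) (process_cdf _ cby).
  by rewrite invariant_copula_cdf//; [case: ax|case: cby].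
have [hD1 hD2] : is_copula_of (X t) (X (t + h)%N) (copula (X t) (X (t + h)%N)).
  exact: (xgetI _ hXY).
apply: (copula_eq_of_dense hD1 hC (mp_cdf_dense mu01 mu1 mB B0)).
move=> _ _ [a [aI Ba] <-] [b [bI Bb] <-].
have ca := cuts_self aI Ba; have cb := cuts_self bI Bb.
rewrite invariant_copula_cdf// -(process_joint_cdf t h ca cb) hD2.
by rewrite (process_cdf t ca) (process_cdf _ cb).
Qed.

End Process.

(** * Maps made of increasing full branches *)

Section FullBranches.
Context {R : realType}.
Implicit Types (f T a : R -> R) (p q x y : R).

(** A strictly increasing bijection from [p, q[ to [0, 1[.  Continuity and
    f p = 0 follow from these order conditions, which compose directly. *)
Definition full_branch f p q : Prop :=
  [/\ p < q, forall x y, p <= x -> x < y -> y < q -> f x < f y,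
      forall x, p <= x < q -> 0 <= f x < 1 &
      forall y, 0 <= y < 1 -> exists2 x, p <= x < q & f x = y].

(** [node_inverse] is this inverse for an iterate of the map on a node; the value
    at 1 is the limit from the left. *)
Definition branch_inv f p q y : R :=
  if y < 1 then pinv `[p, q[%classic f y else q.

Lemma full_branch_left f p q : full_branch f p q -> f p = 0.
Proof.
move=> [pq finc fI fsurj]; have [|x /andP[px xq] fx] := fsurj 0; first lra.
move: px; rewrite le_eqVlt => /predU1P[->//|px].
have := finc _ _ (lexx _) px xq; have /andP[+ _] := fI p (introT andP (conj (lexx _) pq)).
by rewrite fx; lra.
Qed.

Lemma full_branch_mono f p q x y : full_branch f p q -> p <= x < q -> p <= y < q ->
  (x <= y) = (f x <= f y).
Proof.
move=> [pq finc fI fsurj] /andP[px xq] /andP[py yq].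
case: (ltgtP x y) => [xy|yx|->]; last by rewrite lexx.
- by rewrite ltW// finc.
- by apply/esym/negbTE; rewrite -ltNge finc.
Qed.

Lemma branch_invK f p q y : full_branch f p q -> 0 <= y < 1 ->
  p <= branch_inv f p q y < q /\ f (branch_inv f p q y) = y.
Proof.
move=> [pq finc fI fsurj] yI; have /andP[_ y1] := yI; rewrite /branch_inv y1.
have surjf : set_surj `[p, q[%classic `[0, 1[%classic f.
  move=> v /=; rewrite in_itv/= => /fsurj[x xI <-].
  by exists x => //=; rewrite in_itv.
have yI' : `[0, 1[%classic y by rewrite /= in_itv.
split; last by apply: (@surjpK _ _ (fun=> point) _ _ _ surjf); rewrite inE.
have /(_ _ (imageP _ yI')) := @surjpinv_image_sub _ _ (fun=> point) _ _ _ surjf.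
by rewrite /= in_itv.
Qed.

Lemma branch_inv1 f p q : branch_inv f p q 1 = q.
Proof. by rewrite /branch_inv ltxx. Qed.

(** With [le_branch_inv], the adjunction between f and its inverse: both
    relations persist at y = 1, since x < q and f x < 1 on the branch. *)
Lemma branch_inv_le f p q x y : full_branch f p q -> p <= x < q -> 0 <= y <= 1 ->
  (branch_inv f p q y <= x) = (y <= f x).
Proof.
move=> fb xI /andP[y0]; rewrite le_eqVlt => /predU1P[->|y1].
  rewrite branch_inv1 !leNgt; have /andP[_ ->] := xI.
  by have [_ _ /(_ _ xI)/andP[_ ->] _] := fb.
have yI : 0 <= y < 1 by rewrite y0.
have [gI {2}<-] := branch_invK fb yI.
exact: (full_branch_mono fb).
Qed.

Lemma le_branch_inv f p q x y : full_branch f p q -> p <= x < q -> 0 <= y <= 1 ->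
  (x <= branch_inv f p q y) = (f x <= y).
Proof.
move=> fb xI /andP[y0]; rewrite le_eqVlt => /predU1P[->|y1].
  rewrite branch_inv1 ltW; last by case/andP: xI.
  by have [_ _ /(_ _ xI)/andP[_ /ltW ->] _] := fb.
have yI : 0 <= y < 1 by rewrite y0.
have [gI {2}<-] := branch_invK fb yI.
exact: (full_branch_mono fb).
Qed.

Lemma branch_inv_itv f p q y : full_branch f p q -> 0 <= y <= 1 ->
  p <= branch_inv f p q y <= q.
Proof.
move=> fb /andP[y0]; rewrite le_eqVlt => /predU1P[->|y1].
  by rewrite branch_inv1 lexx ltW//; case: fb.
have yI : 0 <= y < 1 by rewrite y0.
by have [/andP[-> /ltW ->]] := branch_invK fb yI.
Qed.

Lemma branch_inv0 f p q : full_branch f p q -> branch_inv f p q 0 = p.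
Proof.
move=> fb; have [pq _ _ _] := fb.
have I0 : 0 <= (0 : R) <= 1 by lra.
have ppI : p <= p < q by rewrite lexx.
apply/eqP; rewrite eq_le (branch_inv_le fb ppI I0).
by rewrite (full_branch_left fb) lexx/=; case/andP: (branch_inv_itv fb I0).
Qed.

Lemma branch_inv_lt f p q y y' : full_branch f p q -> 0 <= y -> y < y' -> y' <= 1 ->
  branch_inv f p q y < branch_inv f p q y'.
Proof.
move=> fb y0 yy' y'1.
have yI : 0 <= y < 1 by lra.
have [gI fg] := branch_invK fb yI.
have y'I : 0 <= y' <= 1 by lra.
by rewrite ltNge (branch_inv_le fb)// fg -ltNge.
Qed.

(** A branch [p', q'[ of f is pulled back by the branch [p, q[ of T: by the
    adjunction, x lies in the pulled back interval iff T x lies in [p', q'[. *)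
Lemma full_branch_comp f T p q p' q' : full_branch T p q -> full_branch f p' q' ->
  0 <= p' -> q' <= 1 ->
  full_branch (f \o T) (branch_inv T p q p') (branch_inv T p q q').
Proof.
move=> Tb fb p'0 q'1; have [p'q' finc fI fsurj] := fb; have [pq Tinc TI Tsurj] := Tb.
have p'I : 0 <= p' <= 1 by lra.
have q'I : 0 <= q' <= 1 by lra.
have /andP[pp' _] := branch_inv_itv Tb p'I.
have /andP[_ q'q] := branch_inv_itv Tb q'I.
have memT x : branch_inv T p q p' <= x < branch_inv T p q q' -> p <= x < q /\ p' <= T x < q'.
  move=> /andP[h1 h2].
  have xI : p <= x < q by rewrite (le_trans pp' h1) (lt_le_trans h2 q'q).
  split=> //; rewrite -(branch_inv_le Tb xI p'I) h1 /=.
  by rewrite ltNge -(branch_inv_le Tb xI q'I) -ltNge.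
split.
- exact: branch_inv_lt.
- move=> x y px xy yq /=.
  have [/andP[x1 x2] /andP[x3 x4]] : p <= x < q /\ p' <= T x < q'.
    by apply: memT; rewrite px (lt_trans xy yq).
  have [/andP[y1 y2] /andP[y3 y4]] : p <= y < q /\ p' <= T y < q'.
    by apply: memT; rewrite yq (le_trans px (ltW xy)).
  by apply: finc => //; exact: Tinc.
- by move=> x /memT[_ /fI].
move=> y /fsurj[z zI <-].
have z01 : 0 <= z < 1 by lra.
have [gI Tg] := branch_invK Tb z01.
exists (branch_inv T p q z); last by rewrite /= Tg.
by rewrite (branch_inv_le Tb gI p'I) Tg ltNge (branch_inv_le Tb gI q'I) Tg -ltNge.
Qed.

Definition full_branches f (N : nat) (b : nat -> R) : Prop :=
  [/\ b 0%N = 0, b N = 1, f 1 = 1 &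
      forall k, (k < N)%N -> full_branch f (b k) (b k.+1)].

Lemma full_branches_lt f N b i j : full_branches f N b -> (i < j)%N -> (j <= N)%N ->
  b i < b j.
Proof.
move=> [_ _ _ fb]; elim: j => // j IHj; rewrite ltnS leq_eqVlt => /predU1P[->|ij] jN.
  by have [] := fb _ jN.
by apply: lt_trans (IHj ij (ltnW jN)) _; have [] := fb _ jN.
Qed.

Lemma full_branches_le f N b i j : full_branches f N b -> (i <= j)%N -> (j <= N)%N ->
  b i <= b j.
Proof.
move=> fb; rewrite leq_eqVlt => /predU1P[->//|ij] jN.
exact/ltW/(full_branches_lt fb).
Qed.

Lemma full_branches_01 f N b i : full_branches f N b -> (i <= N)%N -> 0 <= b i <= 1.
Proof.
move=> fb iN; have [<- <- _ _] := fb.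
by rewrite !(full_branches_le fb).
Qed.

(** The N branches of f are pulled back once by each of the two branches of T;
    both formulas give c at k = N, where the two lists of end points are
    glued. *)
Lemma full_branches_comp f T c N b : full_branch T 0 c -> full_branch T c 1 -> T 1 = 1 ->
  full_branches f N b -> exists b', full_branches (f \o T) (N + N) b'.
Proof.
move=> T0 T1 T11 fb; have [b0 bN f1 fbk] := fb.
exists (fun k => if (k <= N)%N then branch_inv T 0 c (b k)
                 else branch_inv T c 1 (b (k - N)%N)).
have b'E k : (N <= k)%N -> (if (k <= N)%N then branch_inv T 0 c (b k)
    else branch_inv T c 1 (b (k - N)%N)) = branch_inv T c 1 (b (k - N)%N).
  move=> Nk; case: leqP => // kN; have -> : k = N by apply/eqP; rewrite eqn_leq kN.
  by rewrite bN subnn b0 branch_inv1 (branch_inv0 T1).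
split.
- by rewrite leq0n b0 (branch_inv0 T0).
- by rewrite b'E ?leq_addr// addnK bN branch_inv1.
- by rewrite /= T11.
move=> k kN; have [kltN|Nk] := ltnP k N.
  rewrite (ltnW kltN); apply: full_branch_comp T0 (fbk _ kltN) _ _.
    by case/andP: (full_branches_01 fb (ltnW kltN)).
  by case/andP: (full_branches_01 fb kltN).
rewrite !b'E ?(leq_trans Nk)// subSn//.
have kN' : (k - N < N)%N by rewrite ltn_subLR.
apply: full_branch_comp T1 (fbk _ kN') _ _.
  by case/andP: (full_branches_01 fb (ltnW kN')).
by case/andP: (full_branches_01 fb kN').
Qed.

Lemma full_branches_iter T c h : full_branch T 0 c -> full_branch T c 1 -> T 1 = 1 ->
  exists b, full_branches (iter h T) (2 ^ h) b.
Proof.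
move=> T0 T1 T11; elim: h => [|h [b fb]].
  exists (fun k => k%:R); split=> //= -[|//] _; split=> //=.
  by move=> y yI; exists y.
have -> : iter h.+1 T = iter h T \o T by apply/funext => x; rewrite iterSr.
by rewrite expnS mul2n -addnn; exact: full_branches_comp T0 T1 T11 fb.
Qed.

(** A discrete intermediate value property, for the end points b_k as well as
    for the values F b_k. *)
Lemma exists_step (b : nat -> R) N x : b 0%N <= x -> x < b N ->
  exists2 k, (k < N)%N & b k <= x < b k.+1.
Proof.
move=> b0; elim: N => [|N IHN] xb; first by have := le_lt_trans b0 xb; rewrite ltxx.
have [bx|xb'] := leP (b N) x; first by exists N => //; rewrite bx.
by have [k kN hk] := IHN xb'; exists k => //; exact: ltnW.
Qed.

(** f tends to 1 at q from the left while f q = 0. *)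
Lemma full_branch_not_continuous f p q (K : set R) x : full_branch f p q ->
  p <= x < q -> f q = 0 -> `[x, q]%classic `<=` K -> ~ {within K, continuous f}.
Proof.
move=> fb xI fq0 xqK /(continuous_subspaceW xqK) /(_ q).
have [pq finc fI fsurj] := fb.
have /andP[px xq] := xI.
move=> cq.
have qI : `[x, q]%classic q by rewrite /= in_itv/= lexx ltW.
have : f @ within `[x, q]%classic (nbhs q) --> (0 : R).
  by rewrite -fq0 nbhs_subspace_in//; exact: cq.
move=> /cvgrPdist_lt /(_ (2^-1)).
have h2 : 0 < 2^-1 :> R by [].
move=> /(_ h2).
move=> -[e /= e0 he].
have [z zI fz] := fsurj (2^-1) ltac:(lra).
(* w is in [x, q[, within e of q, and beyond the point where f is 1/2 *)
pose w := Num.max (Num.max x z) (q - e / 2).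
have wq : w < q by rewrite /w !gt_max; lra.
have wx : x <= w by rewrite /w !le_max lexx.
have wz : z <= w by rewrite /w !le_max lexx !orbT.
have we : q - e / 2 <= w by rewrite /w !le_max lexx !orbT.
have := he w; rewrite /ball/= /ball_ ger0_norm ?subr_ge0 ?(ltW wq)//.
have h3 : q - w < e by lra.
rewrite in_itv/= wx (ltW wq) => /(_ h3 erefl).
have wI : p <= w < q by lra.
have fw : 2^-1 <= f w by rewrite -fz -(full_branch_mono fb).
by rewrite sub0r normrN ger0_norm; lra.
Qed.

Lemma full_branch_continuous f p q : full_branch f p q -> f q = 1 ->
  {within `[p, q], continuous f}.
Proof.
move=> fb fq1; have [pq finc fI fsurj] := fb.
have f0 := full_branch_left fb.
apply: segment_inc_surj_continuous.
  move=> x y; rewrite !in_itv/= => /andP[px]; rewrite le_eqVlt => xq.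
  move=> /andP[py]; rewrite le_eqVlt => yq.
  case/predU1P : xq => [->|xq]; case/predU1P : yq => [->|yq].
  - by rewrite !lexx.
  - have yI : p <= y < q by rewrite py.
    by have /andP[_ fy1] := fI _ yI; rewrite fq1 !leNgt yq fy1.
  - have xI : p <= x < q by rewrite px.
    by have /andP[_ fx1] := fI _ xI; rewrite fq1 !ltW.
  by apply/esym/(full_branch_mono fb); lra.
move=> y /=; rewrite f0 fq1 in_itv/= => /andP[y0]; rewrite le_eqVlt => /predU1P[->|y1].
  by exists q => //=; rewrite in_itv/= lexx ltW.
have [|x /andP[px xq] <-] := fsurj y; first by rewrite y0.
by exists x => //=; rewrite in_itv/= px ltW.
Qed.

(** Redefining f at q by its left limit 1 reduces this to the closed interval. *)
Lemma full_branch_continuous_co f p q : full_branch f p q ->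
  {within `[p, q[, continuous f}.
Proof.
move=> fb; pose g x := if x == q then 1 else f x.
have gf x : x < q -> g x = f x by move=> xq; rewrite /g lt_eqF.
have gb : full_branch g p q.
  have [pq finc fI fsurj] := fb; split=> //.
  - by move=> x y px xy yq; rewrite !gf ?finc// (lt_trans xy).
  - by move=> x xI; rewrite gf ?fI//; case/andP: xI.
  - by move=> y /fsurj[x xI <-]; exists x => //; rewrite gf//; case/andP: xI.
have gq : g q = 1 by rewrite /g eqxx.
apply: (@subspace_eq_continuous _ _ _ g).
  by move=> x; rewrite inE/= in_itv/= => /andP[_ xq]; rewrite gf.
apply: continuous_subspaceW (full_branch_continuous gb gq).
by move=> x /=; rewrite !in_itv/= => /andP[-> /ltW].
Qed.

End FullBranches.

(** * Branches as maximal intervals of continuity *)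

Section Nodes.
Context {R : realType}.
Implicit Types (f : R -> R) (b : nat -> R) (x : R).

(** At 1 the value of f is its left limit, at the interior end points it is not:
    hence the bound that includes the right end point only for the last k. *)
Definition branch_set (N : nat) b (k : nat) : set R :=
  [set` Interval (BLeft (b k)) (BSide (k.+1 < N)%N (b k.+1))].

Section FixedBranches.
Context (f : R -> R) (N : nat) (b : nat -> R) (N0 : (0 < N)%N).
Context (fb : full_branches f N b).

Lemma sub_branch_set k : `[b k, b k.+1[%classic `<=` branch_set N b k.
Proof.
by move=> x; rewrite /branch_set /= !in_itv/= => /andP[-> h]; case: ltnP => //= _; exact: ltW.
Qed.

Lemma branch_set_sub k : branch_set N b k `<=` `[b k, b k.+1]%classic.
Proof.
by move=> x; rewrite /branch_set /= !in_itv/=; case: ltnP => //= _ /andP[-> /ltW].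
Qed.

Lemma branch_set_01 k : (k < N)%N -> branch_set N b k `<=` `[0, 1]%classic.
Proof.
move=> kN x /branch_set_sub /=; rewrite !in_itv/= => /andP[h1 h2].
have /andP[+ _] := full_branches_01 fb (ltnW kN).
by have /andP[_] := full_branches_01 fb kN; lra.
Qed.

Lemma branch_set_continuous k : (k < N)%N -> {within branch_set N b k, continuous f}.
Proof.
move=> kN; have [_ bN f1 fbk] := fb; rewrite /branch_set; case: ltnP => [_|Nk].
  exact: full_branch_continuous_co (fbk _ kN).
have Nk' : k.+1 = N by apply/eqP; rewrite eqn_leq kN.
by apply: full_branch_continuous (fbk _ kN) _; rewrite Nk' bN.
Qed.

Lemma branch_set_cover x : 0 <= x <= 1 -> exists2 k, (k < N)%N & branch_set N b k x.
Proof.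
have [b0 bN f1 fbk] := fb; move=> /andP[x0].
rewrite le_eqVlt => /predU1P[->|x1].
  exists N.-1; first by rewrite prednK.
  rewrite /branch_set prednK// ltnn /= in_itv/= bN lexx.
  by case/andP: (full_branches_01 fb (leq_pred N)) => _ ->.
have [||k kN hk] := @exists_step R b N x; [by rewrite b0|by rewrite bN|].
by exists k => //; apply: sub_branch_set; rewrite /= in_itv.
Qed.

(** An interval meeting two different branches contains the left end point of
    the later one together with points before it, where f has a jump. *)
Lemma continuous_sub_branch_set (K : set R) : K `<=` `[0, 1]%classic -> is_interval K ->
  {within K, continuous f} -> exists2 k, (k < N)%N & K `<=` branch_set N b k.
Proof.
move=> K01 Kitv Kcont; have [_ _ _ fbk] := fb.
have [[x Kx]|K0] := pselect (K !=set0); last first.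
  by exists 0%N => // x Kx; case: K0; exists x.
have kP y : K y -> exists2 k, (k < N)%N & branch_set N b k y.
  by move=> /K01 /=; rewrite in_itv/=; exact: branch_set_cover.
have nolt y z i j : K y -> K z -> (i < N)%N -> (j < N)%N -> branch_set N b i y ->
    branch_set N b j z -> ~ (i < j)%N.
  move=> Ky Kz iN jN iy jz ij.
  have iN' : (i.+1 < N)%N by exact: leq_ltn_trans ij jN.
  move: iy; rewrite /branch_set iN' /= in_itv/= => yI.
  have := branch_set_sub jz; rewrite /= in_itv/= => /andP[bjz _].
  have bij := full_branches_le fb ij (ltnW jN).
  apply: (full_branch_not_continuous (fbk _ iN) yI _ _ Kcont).
    exact: full_branch_left (fbk _ iN').
  move=> w /=; rewrite in_itv/= => /andP[yw wb].
  by apply: (Kitv y z) => //; rewrite yw (le_trans wb (le_trans bij bjz)).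
have [k kN kx] := kP x Kx; exists k => // y Ky; have [j jN jy] := kP y Ky.
have [kj|jk|->//] := ltngtP k j; first by case: (nolt x y k j).
by case: (nolt y x j k).
Qed.

Lemma branch_set_inj i j : (i < N)%N -> (j < N)%N ->
  branch_set N b i `<=` branch_set N b j -> i = j.
Proof.
move=> iN jN sij; have [_ _ _ fbk] := fb.
have bi : branch_set N b i (b i).
  by apply: sub_branch_set; rewrite /= in_itv/= lexx (full_branches_lt fb).
have := sij _ bi; rewrite /branch_set /= in_itv/= => /andP[bji bij].
apply/eqP; rewrite eqn_leq; apply/andP; split; rewrite leqNgt; apply/negP => h.
  have bj1 := full_branches_le fb h (ltnW iN).
  by move: bij; rewrite (leq_ltn_trans h iN) /=; lra.
by have := full_branches_lt fb h (ltnW jN); lra.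
Qed.

Lemma is_branchE (J : set R) :
  is_branch f J <-> exists2 k, (k < N)%N & J = branch_set N b k.
Proof.
split=> [[J01 Jitv Jcont Jmax]|[k kN ->]].
  have [k kN Jk] := continuous_sub_branch_set J01 Jitv Jcont.
  exists k => //; apply/esym/Jmax => //; first exact: branch_set_01.
    exact: interval_is_interval.
  exact: branch_set_continuous.
split; [exact: branch_set_01|exact: interval_is_interval|exact: branch_set_continuous|].
move=> K K01 Kitv Kcont kK.
have [j jN Kj] := continuous_sub_branch_set K01 Kitv Kcont.
have kj := branch_set_inj kN jN (subset_trans kK Kj); rewrite -kj in Kj.
by apply/seteqP.
Qed.

Lemma branch_endpointsE : branch_endpoints f = [set` map b (iota 0 N.+1)].
Proof.
have bnd_lt k : (k < N)%N -> (BLeft (b k) < BSide (k.+1 < N)%N (b k.+1))%O.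
  move=> kN; have := full_branches_lt fb (ltnSn k) kN.
  by case: (k.+1 < N)%N => h; rewrite bnd_simp// ltW.
have infE k : (k < N)%N -> inf (branch_set N b k) = b k.
  by move=> kN; exact/inf_itv/bnd_lt.
have supE k : (k < N)%N -> sup (branch_set N b k) = b k.+1.
  by move=> kN; exact/sup_itv/bnd_lt.
have mem_b k : (k <= N)%N -> [set` map b (iota 0 N.+1)] (b k).
  by move=> kN; apply/mapP; exists k => //; rewrite mem_iota.
apply/seteqP; split=> x.
  move=> [[J /is_branchE[k kN ->] <-]|[J /is_branchE[k kN ->] <-]].
    by rewrite infE//; apply: mem_b; exact: ltnW.
  by rewrite supE//; exact: mem_b.
move=> /mapP[k]; rewrite mem_iota/= add0n ltnS leq_eqVlt => /predU1P[->|kN] ->; last first.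
  by left; exists (branch_set N b k); [apply/is_branchE; exists k|exact: infE].
have NN : (N.-1 < N)%N by rewrite prednK.
right; exists (branch_set N b N.-1); first by apply/is_branchE; exists N.-1.
by rewrite supE// prednK.
Qed.

Lemma sort_branch_endpoints :
  sort <=%R (finmap.enum_fset (fset_set (branch_endpoints f))) = map b (iota 0 N.+1).
Proof.
apply: lt_sorted_eq.
- by rewrite sort_lt_sorted; exact: finmap.fset_uniq.
- apply: (homo_sorted_in (e := ltn) (P := [pred k | k <= N]%N)).
  + by move=> i j _ jN ij; exact: (full_branches_lt fb).
  + by apply/allP => k; rewrite mem_iota/= ltnS.
  + exact: iota_ltn_sorted.
move=> x; rewrite mem_sort branch_endpointsE in_fset_set; last exact: finite_seq.
by apply/idP/idP; rewrite inE.
Qed.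

Lemma nth_branch_endpoints k : (k <= N)%N ->
  nth 0 (sort <=%R (finmap.enum_fset (fset_set (branch_endpoints f)))) k = b k.
Proof.
move=> kN; rewrite sort_branch_endpoints (nth_map 0%N) ?size_iota//.
by rewrite nth_iota.
Qed.

End FixedBranches.

(** With g x = x + x^(1+s), which increases from 0 to 2 on [0, 1], the branches
    meet at the point c where g c = 1.  The power is continuous on [0, 1], 0
    included, as an increasing map with inverse y^(1/(1+s)). *)
Lemma mp_branches (s : R) : 0 < s -> exists c : R,
  [/\ full_branch (mp_map s) 0 c, full_branch (mp_map s) c 1 & mp_map s 1 = 1].
Proof.
move=> s0; pose g x : R := x + x `^ (1 + s).
have s10 : 0 < 1 + s by lra.
have g0 : g 0 = 0 by rewrite /g powR0 ?addr0// gt_eqF.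
have g1 : g 1 = 2 by rewrite /g powR1.
have ginc x y : 0 <= x -> x < y -> g x < g y.
  move=> x0 xy; rewrite /g ltrD// gt0_ltr_powR// nnegrE; lra.
have gcont : {within `[0, 1], continuous g}.
  have pcont : {within `[0, 1], continuous (fun x : R => x `^ (1 + s))}.
    apply: segment_inc_surj_continuous.
      apply: le_mono_in => x y; rewrite !in_itv/= => /andP[x0 _] /andP[y0 _] xy.
      by rewrite gt0_ltr_powR// nnegrE.
    move=> y /=; rewrite powR0 ?gt_eqF// powR1 in_itv/= => /andP[y0 y1].
    exists (y `^ (1 + s)^-1) => /=.
      have r0 : 0 <= (1 + s)^-1 by rewrite invr_ge0 ltW.
      have := ge0_ler_powR r0 (x := y) (y := 1); rewrite !nnegrE powR1 => h.
      by rewrite in_itv/= powR_ge0 h.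
    by rewrite -powRrM mulVf ?powRr1// gt_eqF.
  apply: within_continuousD pcont => //.
  by apply: continuous_subspaceT => x; exact: cvg_id.
have ivt v : 0 <= v <= 2 -> exists2 x, 0 <= x <= 1 & g x = v.
  move=> vI; have := IVT ler01 gcont (v := v).
  rewrite g0 g1 min_l ?max_r ?ler0n// vI => /(_ isT)[x + gx].
  by rewrite in_itv/=; exists x.
have glt x y : 0 <= x -> 0 <= y -> (x < y) = (g x < g y).
  move=> x0 y0; case: (ltgtP x y) => [xy|yx|->]; last by rewrite ltxx.
    by rewrite ginc.
  by apply/esym/negbTE; rewrite -leNgt ltW// ginc.
have [|c cI gc] := ivt 1; first lra.
have /andP[cge0 cle1] := cI.
have c0 : 0 < c by rewrite glt// g0 gc.
have c1 : c < 1 by rewrite glt// g1 gc; lra.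
have Tl x : 0 <= x -> x < c -> mp_map s x = g x.
  by move=> x0; rewrite glt// gc /mp_map => ->.
have Tr x : c <= x -> mp_map s x = g x - 1.
  by move=> cx; rewrite /mp_map -/(g x) -gc -glt ?ltNge ?cx// ?gc//; lra.
exists c; split.
- split=> //.
  + move=> x y x0 xy yc; rewrite !Tl// ?ginc//; lra.
  + move=> x /andP[x0 xc]; rewrite Tl//; move: (xc); rewrite glt// gc => ->.
    by rewrite /g addr_ge0// powR_ge0.
  move=> y /andP[y0 y1]; have [|x /andP[x0 x1] gx] := ivt y; first lra.
  have xc : x < c by rewrite glt// gx gc.
  by exists x; rewrite ?x0 ?Tl.
- split=> //.
  + move=> x y cx xy y1; rewrite !Tr ?ltrD2r ?ginc//; lra.
  + move=> x /andP[cx x1].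
    have h1 : g x < g 1 by apply: ginc => //; lra.
    have h2 : g c <= g x by rewrite leNgt -glt -?leNgt//; lra.
    by rewrite Tr//; lra.
  move=> y /andP[y0 y1]; have [|x /andP[x0 x1] gx] := ivt (y + 1); first lra.
  have xc : c <= x by rewrite leNgt glt// gx gc; lra.
  have x1' : x < 1 by rewrite glt// gx g1; lra.
  by exists x; rewrite ?xc// Tr// gx; lra.
by rewrite Tr// g1; lra.
Qed.

End Nodes.

(** * The Manneville-Pomeau map and the explicit copula *)

Section MannevillePomeauMap.
Context {R : realType} (s : R).

Lemma measurable_mp_map : measurable_fun setT (mp_map s).
Proof.
have mg : measurable_fun setT (fun x : R => x + x `^ (1 + s)).
  by apply: measurable_funD; [exact: measurable_id|exact: measurable_powR].
apply: measurable_fun_ifT => //; first exact: measurable_fun_ltr.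
by apply: measurable_funB.
Qed.

Lemma mp_map_01 (x : R) : 0 < s -> 0 <= x <= 1 -> 0 <= mp_map s x <= 1.
Proof.
move=> s0 /andP[x0 x1]; have [c [[_ _ T0 _] [_ _ T1 _] T11]] := mp_branches s0.
have [xc|cx] := ltP x c.
  by have := T0 x; rewrite x0 xc => /(_ isT)/andP[-> /ltW].
move: x1; rewrite le_eqVlt => /predU1P[->|x1]; first by rewrite T11 ler01 lexx.
by have := T1 x; rewrite cx x1 => /(_ isT)/andP[-> /ltW].
Qed.

Lemma mp_map_iter_branches (h : nat) : 0 < s ->
  exists2 b, full_branches (iter h (mp_map s)) (2 ^ h) b &
    forall k, (k <= 2 ^ h)%N -> node s h k = b k.
Proof.
move=> s0; have [c [T0 T1 T11]] := mp_branches s0.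
have [b fb] := full_branches_iter h T0 T1 T11; exists b => // k kN.
by apply: nth_branch_endpoints fb _ kN; rewrite expn_gt0.
Qed.

End MannevillePomeauMap.

Section JointBranches.
Context {R : realType} (mu : probability R R) (f : R -> R) (N : nat) (b : nat -> R).
Context (mu01 : mu `[0, 1]%classic = 1%E).
Context (mu1 : forall x, mu [set x] = 0%E).
Context (mf : measurable_fun setT f).
Context (fb : full_branches f N b).

Local Notation F := (mp_cdf mu).
Local Notation g k y := (branch_inv f (b k) (b k.+1) y).

Lemma mp_cdf_min (x y : R) : F (Num.min x y) = Num.min (F x) (F y).
Proof.
have [xy|/ltW yx] := leP x y; first by rewrite min_l// mp_cdf_le.
by rewrite min_r// mp_cdf_le.
Qed.

(** Up to the null point b_{k+1}, the points of ]b_k, x] with f <= y are those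
    of ]b_k, min(x, g_k y)]. *)
Lemma joint_cdf_branch (k : nat) (x y : R) : (k < N)%N -> b k <= x <= b k.+1 ->
  0 <= y <= 1 ->
  joint_cdf mu f x y = joint_cdf mu f (b k) y + (Num.min (F x) (F (g k y)) - F (b k)).
Proof.
move=> kN /andP[bx xb] yI; have [_ _ _ /(_ _ kN) fbk] := fb.
have mpre : measurable (f @^-1` `[0, y]%classic).
  by rewrite -[X in measurable X]setTI; exact: mf.
have /andP[b0 _] := full_branches_01 fb (ltnW kN).
have /andP[bg _] := branch_inv_itv fbk yI.
have bm : b k <= Num.min x (g k y) by rewrite le_min bx.
rewrite /joint_cdf (fine_prob_split mu mpre b0 bx); congr (_ + _).
rewrite -mp_cdf_min (mp_cdf_split mu b0 bm) addrAC subrr add0r; congr fine.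
apply: (measure_eq_off_null (m := mu) (Z := [set b k.+1])) => //.
- exact: measurableI.
- exact: mu1.
move=> z /eqP zb; rewrite /= !in_itv/=.
have [bz|] := ltP (b k) z; last by split=> [[]|].
rewrite le_min; have [zx|] := leP z x; last by split=> [[]|].
have zI : b k <= z < b k.+1 by rewrite ltW// lt_neqAle zb (le_trans zx xb).
rewrite (le_branch_inv fbk zI yI); have [_ _ /(_ _ zI)/andP[-> _] _] := fbk.
by split=> [[]|].
Qed.

Lemma joint_cdf_node (m : nat) (y : R) : (m <= N)%N -> 0 <= y <= 1 ->
  joint_cdf mu f (b m) y = \sum_(0 <= k < m) (F (g k y) - F (b k)).
Proof.
move=> + yI; elim: m => [_|m IHm mN].
  by have [-> _ _ _] := fb; rewrite big_nil (joint_cdf0l mu1 mf).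
have [_ _ _ /(_ _ mN) fbm] := fb.
have mI : b m <= b m.+1 <= b m.+1 by rewrite lexx andbT ltW//; case: fbm.
rewrite (joint_cdf_branch mN mI yI) IHm ?(ltnW mN)// big_nat_recr//=.
rewrite min_r//; apply: mp_cdf_le.
by case/andP: (branch_inv_itv fbm yI).
Qed.

Lemma joint_cdf_in_branch (n : nat) (x y : R) : (n < N)%N -> b n <= x <= b n.+1 ->
  0 <= y <= 1 ->
  joint_cdf mu f x y = \sum_(0 <= k < n) (F (g k y) - F (b k))
    + Num.min (F x) (F (g n y)) - F (b n).
Proof.
move=> nN xI yI; rewrite (joint_cdf_branch nN xI yI) joint_cdf_node ?(ltnW nN)//.
by rewrite addrA.
Qed.

(** The index is found from values of F, so a point x with F x = u may precede
    b_n if F is constant between; it is then replaced by b_n. *)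
Lemma find_branch (u : R) : 0 <= u < 1 ->
  exists2 x, F x = u &
    let n := find (fun k => F (b k) <= u < F (b k.+1)) (iota 0 N) in
    (n < N)%N /\ b n <= x <= b n.+1.
Proof.
move=> /andP[u0 u1]; have [b0 bN _ _] := fb.
have [||k kN kP] := @exists_step R (F \o b) N u.
- by rewrite /= b0 (mp_cdf0 mu1).
- by rewrite /= bN (mp_cdf1 mu01).
pose p k := F (b k) <= u < F (b k.+1); rewrite -/p.
have hp : has p (iota 0 N) by apply/hasP; exists k => //; rewrite mem_iota.
have nN : (find p (iota 0 N) < N)%N by move: hp; rewrite has_find size_iota.
have := nth_find 0%N hp; rewrite nth_iota// add0n.
move: (find p (iota 0 N)) nN => n nN /andP[hn1 hn2].
have uI : 0 <= u <= 1 by rewrite u0 ltW.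
have [x xI Fx] := mp_cdf_surj mu01 mu1 uI.
exists (Num.max x (b n)); last first.
  split=> //; rewrite le_max lexx orbT/= ge_max (full_branches_le fb (leqnSn n) nN) andbT.
  by rewrite leNgt; apply/negP => /ltW/(mp_cdf_le mu); rewrite Fx leNgt hn2.
have [xb|bx] := leP x (b n); last by [].
by apply/eqP; rewrite eq_le hn1 -Fx mp_cdf_le.
Qed.

End JointBranches.

Unset Implicit Arguments.

Theorem proposition3p2 (R : realType) (s : R) (hs0 : 0 < s) (hs1 : s < 1)
  (mu : probability R R) (hmu : is_mp_measure s mu)
  (d : measure_display) (Om : measurableType d) (P : probability Om R)
  (U0 : {RV P >-> R}) (phi : R -> R) (X : nat -> {RV P >-> R})
  (hphi : mu.-integrable `[0, 1]%classic (EFin \o phi))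
  (hinc : ae_increasing phi)
  (hX : is_mp_process s mu U0 phi X)
  (t h : nat) (hh : h <> 0%N) (u v : R)
  (hu : 0 <= u <= 1) (hv : 0 <= v <= 1) :
  let F0 := mp_cdf mu in
  let n0 := mp_index mu s h u in
  copula (X t) (X (t + h)%N) u v =
    (\sum_(0 <= k < n0) (mp_F mu s h k v - F0 (node s h k)))
      * \1_[set n : nat | n <> 0%N] n0
    + Num.min u (mp_F mu s h n0 v) - F0 (node s h n0).
Proof.
move=> F0 n0.
have [mu01 mu_inv mu_ac] := hmu; have [U0_law X_def] := hX.
have ac A : measurable A -> lebesgue_measure A = 0%E -> mu A = 0%E.
  by move/null_content_dominatesP: mu_ac; exact.
have mu1 x : mu [set x] = 0%E by apply: ac => //; exact: lebesgue_measure_set1.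
have [N' [B [mB B0 N'B]] phi_inc'] := hinc.
have phi_inc x y : 0 <= x -> x < y -> y <= 1 -> ~ B x -> ~ B y -> phi x < phi y.
  move=> x0 xy y1 Bx By; apply: phi_inc' => //; rewrite inE; split.
  - by rewrite /= in_itv/=; lra.
  - by move/N'B.
  - by rewrite /= in_itv/=; lra.
  - by move/N'B.
have mT := measurable_mp_map s; have T01 x := @mp_map_01 _ s x hs0.
have muB := ac B mB B0.
rewrite (process_copula mu01 mu1 mT T01 mu_inv mB muB phi_inc U0_law X_def)//.
have [b fb nodeE] := mp_map_iter_branches h hs0.
have mf := measurable_iter mT h.
have [yI Fy] := mp_quantileP mu01 mu1 hv.
have {}nE k : (k < 2 ^ h)%N -> mp_F mu s h k v =
    F0 (branch_inv (iter h (mp_map s)) (b k) (b k.+1) (mp_quantile mu v)).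
  by move=> kN; rewrite -!nodeE// ltnW.
have [x [Fx n0N xI]] : exists x, [/\ F0 x = u, (n0 < 2 ^ h)%N & b n0 <= x <= b n0.+1].
  have [b0 bN _ _] := fb.
  rewrite /n0 /mp_index; case: eqP => [->|/eqP un1].
    exists 1; rewrite /F0 (mp_cdf1 mu01) prednK ?expn_gt0// bN lexx andbT.
    split=> //.
    by case/andP: (full_branches_01 fb (leq_pred (2 ^ h))).
  have uI : 0 <= u < 1 by case/andP: hu => -> u1; rewrite lt_neqAle un1.
  have [x Fx [nN xI]] := find_branch mu01 mu1 fb uI.
  exists x; rewrite (@eq_in_find _ _ (fun k => F0 (b k) <= u < F0 (b k.+1))).
    by split.
  by move=> k; rewrite mem_iota/= add0n => kN; rewrite !nodeE// ltnW.
have x01 : 0 <= x <= 1.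
  have /andP[h1 _] := full_branches_01 fb (ltnW n0N).
  by have /andP[_ h2] := full_branches_01 fb n0N; lra.
have [quI Fqu] := mp_quantileP mu01 mu1 hu.
transitivity (joint_cdf mu (iter h (mp_map s)) x (mp_quantile mu v)).
  apply: (joint_cdf_eq mu1 mf (iter_01 T01 h)
    (iter_inv mu01 mT mu_inv h)) => //.
  by rewrite Fqu -Fx.
rewrite (joint_cdf_in_branch mu1 mf fb n0N xI yI) -/F0 Fx nE// -nodeE ?(ltnW n0N)//.
congr (_ + _ - _).
have -> : \sum_(0 <= k < n0) (mp_F mu s h k v - F0 (node s h k)) =
    \sum_(0 <= k < n0) (F0 (branch_inv (iter h (mp_map s)) (b k) (b k.+1)
      (mp_quantile mu v)) - F0 (b k)).
  apply: eq_big_nat => k /andP[_ kn0].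
  by have kN := ltn_trans kn0 n0N; rewrite nE// nodeE// ltnW.
rewrite indicE; have [->|n00] := posnP n0; first by rewrite big_nil mul0r.
by rewrite mem_set ?mulr1//= => n00'; rewrite n00' in n00.
Qed.
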